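(* Let $\mathcal M(q)=(\mathcal P,\mathcal Z)$ be a finite Möbius plane of order $q$ and let $B$ be a blocking set of $\mathcal M(q)$ of minimum cardinality. Then \[|B|<\frac{q^2+1}{q+1}\left(1+\log(q(q+1))\right).\]
   Context: A Möbius plane is a pair $(\mathcal P,\mathcal Z)$, where $\mathcal P$ is a set (of points) and $\mathcal Z$ is a set of subsets of $\mathcal P$ (circles), such that: (i) any three pairwise distinct points lie on exactly one circle; (ii) if $z\in\mathcal Z$, $P\in z$ and $Q\in\mathcal P\setminus z$, there is exactly one circle $z'$ through $P$ and $Q$ with $z\cap z'=\{P\}$; (iii) there is at least one circle and every circle has at least three points; (iv) for every circle $z$ there is a point not on $z$. It is finite if $\mathcal P$ is finite; then all circles have the same number $q+1$ of points, and $q$ is the order. A blocking set of the Möbius plane is a set $B\subseteq\mathcal P$ meeting every circle. Here $\log$ is the natural logarithm. *)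

(* Defs.v *)
From mathcomp Require Import all_boot all_order all_algebra.

Set Implicit Arguments.
Unset Strict Implicit.
Unset Printing Implicit Defensive.

Section Mobius.
Variables (T : finType) (Z : {set {set T}}).

(* The point set is the whole finite type T; Z is the set of circles. *)
Record mobius_plane : Prop := MobiusPlane {
  mobius_three_points : forall P Q S : T, P != Q -> P != S -> Q != S ->
    exists! z : {set T}, [/\ z \in Z, P \in z, Q \in z & S \in z];
  mobius_touching : forall (z : {set T}) (P Q : T),
    z \in Z -> P \in z -> Q \notin z ->
    exists! z' : {set T},
      [/\ z' \in Z, P \in z', Q \in z' & z :&: z' = [set P]];
  mobius_circle : exists z : {set T}, z \in Z;
  mobius_circle_card : forall z : {set T}, z \in Z -> 3 <= #|z|;
  mobius_off_circle : forall z : {set T}, z \in Z -> exists P : T, P \notin z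
}.

Definition mobius_order (q : nat) : Prop :=
  forall z : {set T}, z \in Z -> #|z| = q.+1.

Definition blocking_set (B : {set T}) : Prop :=
  forall z : {set T}, z \in Z -> B :&: z != set0.

Definition minimum_blocking_set (B : {set T}) : Prop :=
  blocking_set B /\ forall B' : {set T}, blocking_set B' -> #|B| <= #|B'|.

End Mobius.

(* Main.v *)
Require Import Defs.
From mathcomp Require Import all_boot all_order all_algebra.
From mathcomp Require Import reals exp.
From mathcomp Require Import zify.

(** Remove circles greedily, each time picking a point on the largest number of
    remaining circles. Dual fitting bounds the size of the resulting blocking
    set B of an r-uniform hypergraph: r |B| is at most the sum over the points x of
    H(deg x), where H(d) = 1 + 1/2 + ... + 1/d.
    A Möbius plane of order q has q^2 + 1 points, each on q(q+1) circles of
    q + 1 points, and H(d) < 1 + log d for d > 1. *)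

Set Implicit Arguments.
Unset Strict Implicit.
Unset Printing Implicit Defensive.

Import Order.TTheory GRing.Theory Num.Theory.
Local Open Scope ring_scope.

Section Star.
Variable T : finType.
Implicit Types (F : {set {set T}}) (A : {set T}) (x : T).

Definition star F x : {set {set T}} := [set z in F | x \in z].

(** Double counting of the incidences between points of [A] and edges of [F]; the greedy bound and
    the circle counts rest on it. *)
Lemma sum_card_star F A :
  (\sum_(x in A) #|star F x| = \sum_(z in F) #|z :&: A|)%N.
Proof.
transitivity (\sum_(x in A) \sum_(z in F | x \in z) 1)%N.
  by apply: eq_bigr => x _; rewrite sum1dep_card.
rewrite (exchange_big_dep (mem F)) /=; last by move=> x z _ /andP[].
apply: eq_bigr => z zF; rewrite sum1dep_card; apply: eq_card => x.
by rewrite !inE zF andbC.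
Qed.

Lemma card_star_setD F x y :
  #|star F y| = (#|star (F :\: star F x) y| + #|star (star F x) y|)%N.
Proof.
rewrite addnC -(cardsID (star F x) (star F y)); congr (_ + _)%N;
  apply: eq_card => z; rewrite !inE; by do 3 case: (_ \in _).
Qed.

End Star.

Section Greedy.
Variable R : realFieldType.

Definition harmonic_sum n : R := \sum_(i < n) i.+1%:R^-1.

Lemma harmonic_sumS n : harmonic_sum n.+1 = harmonic_sum n + n.+1%:R^-1.
Proof. exact: big_ord_recr. Qed.

Lemma harmonic_sum_ge0 n : 0 <= harmonic_sum n.
Proof. by apply: sumr_ge0 => i _; rewrite invr_ge0 ler0n. Qed.

(** The [d] added terms have denominators at most [m + d], so each is at least [1 / k]. *)
Lemma harmonic_sum_addn m d k :
  (m + d <= k)%N -> harmonic_sum m + d%:R / k%:R <= harmonic_sum (m + d).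
Proof.
elim: d => [|d IHd] mdk; first by rewrite mul0r addn0 addr0.
rewrite addnS in mdk *; rewrite harmonic_sumS -natr1 mulrDl mul1r addrA lerD ?IHd ?(ltnW mdk) //.
by rewrite lef_pV2 ?posrE ?ltr0n ?ler_nat // (leq_trans _ mdk).
Qed.

(* Removing all the edges through a vertex of maximal degree [k] lowers the
   sum of [harmonic_sum (degree x)] by at least the sum over these [k] edges
   of [#|z| / k], that is by at least [r]. *)
Lemma greedy_blocking_set (T : finType) (F : {set {set T}}) (r : nat) :
    (0 < r)%N -> (forall z, z \in F -> r <= #|z|)%N ->
  exists2 B : {set T}, blocking_set F B
    & r%:R * #|B|%:R <= \sum_x harmonic_sum #|star F x|.
Proof.
move=> r_gt0; have [n] := ubnP #|F|; elim: n F => // n IHn F ltFn Fr.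
have [->|[z0 z0F]] := set_0Vmem F.
  exists set0; first by move=> z; rewrite inE.
  by rewrite cards0 mulr0 sumr_ge0 // => x _; apply: harmonic_sum_ge0.
have /card_gt0P[x0 x0z0] : (0 < #|z0|)%N by rewrite (leq_trans r_gt0) ?Fr.
have [x _ xmax] := @arg_maxnP _ x0 xpredT (fun x => #|star F x|) isT.
set S := star F x in xmax; set k := #|S| in xmax.
have k_gt0 : (0 < k)%N.
  by apply: leq_trans (xmax x0 isT); apply/card_gt0P; exists z0; rewrite inE z0F.
have SF : S \subset F by apply/subsetP => z; rewrite inE => /andP[].
have [||B' B'F leB'] := IHn (F :\: S).
- move: k_gt0 ltFn; rewrite /k -(cardsID S F) (setIidPr SF); lia.
- by move=> z /setDP[/Fr].
exists (x |: B') => [z zF|].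
  have [xz|xz] := boolP (x \in z).
    by apply/set0Pn; exists x; rewrite !inE eqxx.
  have /set0Pn[y /setIP[yB yz]] : B' :&: z != set0.
    by apply: B'F; rewrite !inE zF (negbTE xz).
  by apply/set0Pn; exists y; rewrite !inE yB yz orbT.
have leB : (#|x |: B'| <= #|B'|.+1)%N by rewrite cardsU1; case: (_ \notin _); lia.
apply: (@le_trans _ _ (r%:R * #|B'|%:R + r%:R)).
  by rewrite -!natrM -natrD ler_nat; nia.
apply: le_trans (_ : \sum_y (harmonic_sum #|star (F :\: S) y|
                             + #|star S y|%:R / k%:R) <= _).
  rewrite big_split /=; apply: lerD => //; rewrite -mulr_suml -natr_sum.
  rewrite (eq_bigl (mem [set: T])) => [|y]; last by rewrite !inE.
  rewrite sum_card_star ler_pdivlMr ?ltr0n // -natrM ler_nat.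
  rewrite mulnC -sum_nat_const; apply: leq_sum => z zS.
  by rewrite setIT Fr // (subsetP SF).
(* Maximality of [k] bounds the old degree of [y], as [harmonic_sum_addn] requires. *)
apply: ler_sum => y _; rewrite (card_star_setD F x y).
by apply: harmonic_sum_addn; rewrite -card_star_setD; apply: xmax.
Qed.

End Greedy.

Section HarmonicLn.
Variable R : realType.

Lemma ln_ltB1 (x : R) : 0 < x -> x != 1 -> ln x < x - 1.
Proof.
move=> x_gt0 x_neq1.
have /expR_gt1Dx : ln x != 0 by rewrite ln_eq0.
by rewrite lnK ?posrE // ltrBrDl.
Qed.

Lemma harmonic_sum_lt_ln n :
  (1 < n)%N -> harmonic_sum R n < 1 + ln (n%:R : R).
Proof.
(* This is [ln_ltB1] at [m / (m + 1)], with signs reversed. *)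
have step m : (0 < m)%N -> (m.+1%:R^-1 : R) < ln m.+1%:R - ln m%:R.
  move=> m_gt0; have m0 : 0 < m%:R :> R by rewrite ltr0n.
  have m1 : 0 < m.+1%:R :> R by rewrite ltr0n.
  have ratioE : m%:R / m.+1%:R - 1 = - m.+1%:R^-1 :> R.
    rewrite -[X in _ - X](divff (lt0r_neq0 m1)) -mulrBl -[X in _ - X]natr1.
    by rewrite opprD addrA subrr sub0r mulN1r.
  rewrite -ltrN2 opprB -ln_div ?posrE // -ratioE ln_ltB1 ?divr_gt0 //.
  by rewrite -subr_eq0 ratioE oppr_eq0 invr_eq0 lt0r_neq0.
(* The induction starts at 2, since at 1 both sides are equal. *)
case: n => [//|[//|n]] _; elim: n => [|n IHn]; rewrite harmonic_sumS.
  have := step 1%N isT.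
  by rewrite ln1 subr0 harmonic_sumS /harmonic_sum big_ord0 add0r invr1 ltrD2l.
by rewrite -ltrBrDr (lt_trans IHn) // ltrBrDr -addrA ltrD2l -ltrBrDl step.
Qed.

End HarmonicLn.

Section MobiusCounting.
Variables (T : finType) (Z : {set {set T}}) (q : nat).
Hypotheses (mobZ : mobius_plane Z) (ordZ : mobius_order Z q).

Lemma card_exists_unique (U : finType) (A : {set U}) :
  (exists! x, x \in A) -> #|A| = 1%N.
Proof.
move=> [x [xA Ax]]; apply/eqP/cards1P; exists x; apply/setP => y.
by rewrite inE; apply/idP/eqP => [/Ax|->].
Qed.

Lemma mobius_order_gt1 : (1 < q)%N.
Proof.
have [z zZ] := mobius_circle mobZ.
by have := mobius_circle_card mobZ zZ; rewrite ordZ.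
Qed.

Lemma card_star3 P Q S : P != Q -> P != S -> Q != S ->
  #|star (star (star Z P) Q) S| = 1%N.
Proof.
move=> PQ PS QS; apply: card_exists_unique.
have [z [[zZ Pz Qz Sz] zU]] := mobius_three_points mobZ PQ PS QS.
exists z; split; first by rewrite !inE zZ Pz Qz.
by move=> y; rewrite !inE -!andbA => /and4P[]; move=> *; apply: zU.
Qed.

(** A circle touching at [P] some circle through [P] and [Q] meets the latter only in [P], hence
    misses [Q]. *)
Lemma mobius_separating_circle P Q : P != Q ->
  exists2 z, z \in star Z P & Q \notin z.
Proof.
move=> PQ; have [z0 z0Z] := mobius_circle mobZ.
have [S] : exists S, S \in ~: [set P; Q].
  apply/card_gt0P; rewrite cardsCs setCK cards2 PQ subn_gt0.
  exact: leq_trans (mobius_circle_card mobZ z0Z) (max_card _).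
rewrite !inE negb_or ![S == _]eq_sym => /andP[PS QS].
have [z1 [[z1Z Pz1 Qz1 _] _]] := mobius_three_points mobZ PQ PS QS.
have [V Vz1] := mobius_off_circle mobZ z1Z.
have [z [[zZ Pz _ zz1] _]] := mobius_touching mobZ z1Z Pz1 Vz1.
move: zz1 => /setP/(_ Q); rewrite !inE Qz1 [Q == P]eq_sym (negbTE PQ) /= => Qz.
by exists z; rewrite ?inE ?zZ ?Qz.
Qed.

(* Take a circle [z] through [P] but not [Q]. A circle through [P] and [Q]
   either meets [z] in exactly one of its [q] points other than [P], or is the
   unique circle through [Q] touching [z] at [P]. *)
Lemma card_star2 P Q : P != Q -> #|star (star Z P) Q| = q.+1.
Proof.
move=> PQ; have [z] := mobius_separating_circle PQ.
rewrite inE => /andP[zZ Pz] Qz; set L := star _ _.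
have /card_exists_unique touch :
    exists! y, y \in [set y in L | y :&: (z :\ P) == set0].
  have touchE (y : {set T}) : P \in y -> (y :&: (z :\ P) == set0) = (z :&: y == [set P]).
    move=> Py; rewrite setIDA setD_eq0 setIC eqEsubset sub1set inE Pz Py.
    by rewrite !andbT.
  have [y [[yZ Py Qy yz] yU]] := mobius_touching mobZ zZ Pz Qz.
  exists y; split; first by rewrite !inE yZ Py Qy touchE // yz eqxx.
  move=> x; rewrite !inE -!andbA => /and4P[xZ Px Qx].
  by rewrite touchE // => /eqP xz; apply: yU.
have zP : #|z :\ P| = q by have := cardsD1 P z; rewrite Pz ordZ // => -[].
have count_meet : (\sum_(y in L) #|y :&: (z :\ P)| = q)%N.
  rewrite -sum_card_star -[RHS]zP -sum1_card; apply: eq_bigr => S.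
  rewrite !inE => /andP[SP Sz]; apply: card_star3 => //; first by rewrite eq_sym.
  by apply: contraNneq Qz => ->.
(* Two common points besides [P] would force [y = z], but [Q] lies only on [y]. *)
have meet_le1 y : y \in L -> (#|y :&: (z :\ P)| <= 1)%N.
  rewrite !inE -andbA => /and3P[yZ Py Qy]; apply: contraNT Qz; rewrite -ltnNge.
  move=> /card_gt1P[S [V []]]; rewrite !inE ![_ == P]eq_sym.
  move=> /and3P[Sy PS Sz] /and3P[Vy PV Vz] SV.
  have [x [_ xU]] := mobius_three_points mobZ PS PV SV.
  have <- : y = z by rewrite -(xU y) // -(xU z).
  by [].
rewrite -[RHS]addn1 -[X in (_ + X)%N]touch -[X in (X + _)%N]count_meet.
rewrite -sum1_card -sum1dep_card.
rewrite big_mkcondr -big_split; apply: eq_bigr => y /meet_le1 /=.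
by rewrite -cards_eq0; case: #|_| => [|[]].
Qed.

(** For fixed [P != Q], the [q + 1] circles through both partition the remaining points into classes
    of size [q - 1]. *)
Lemma card_mobius_points : #|T| = (q ^ 2).+1.
Proof.
have [z0 z0Z] := mobius_circle mobZ.
have /card_gt1P[P [Q [_ _ PQ]]] : (1 < #|z0|)%N.
  exact: ltnW (mobius_circle_card mobZ z0Z).
have := sum_card_star (star (star Z P) Q) (~: [set P; Q]).
rewrite (eq_bigr (fun=> 1%N)) => [|S]; last first.
  rewrite !inE negb_or ![S == _]eq_sym => /andP[PS QS]; exact: card_star3.
rewrite [X in _ = X -> _](eq_bigr (fun=> q.-1)) => [|z]; last first.
  rewrite !inE -andbA => /and3P[zZ Pz Qz]; rewrite -setDE.
  by rewrite cardsDS ?subUset ?sub1set ?Pz // cards2 PQ ordZ // subSS subn1.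
rewrite sum1_card sum_nat_const card_star2 // cardsCs setCK cards2 PQ.
(* These bounds make the truncated subtractions [#|T| - 2] and [q.-1] exact. *)
have := mobius_order_gt1; have := max_card (mem [set P; Q]); rewrite cards2 PQ.
case: q => // p; nia.
Qed.

(** Each of the [q ^ 2] other points shares [q + 1] circles with [P], and each circle through [P]
    has [q] other points; cancel [q]. *)
Lemma card_star1 P : #|star Z P| = (q * q.+1)%N.
Proof.
have := sum_card_star (star Z P) [set~ P].
rewrite (eq_bigr (fun=> q.+1)) => [|Q]; last first.
  by rewrite !inE eq_sym => /card_star2.
rewrite [X in _ = X -> _](eq_bigr (fun=> q)) => [|z]; last first.
  rewrite inE -setDE => /andP[zZ Pz].
  by have := cardsD1 P z; rewrite Pz ordZ // => -[].
rewrite !sum_nat_const cardsC1 card_mobius_points /=.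
have := mobius_order_gt1; nia.
Qed.

End MobiusCounting.

Theorem mainTheorem8 (R : realType) (T : finType) (Z : {set {set T}})
    (q : nat) (B : {set T}) :
  mobius_plane Z -> mobius_order Z q -> minimum_blocking_set Z B ->
  #|B|%:R < (q%:R ^+ 2 + 1) / (q%:R + 1) * (1 + ln (q%:R * (q%:R + 1))) :> R.
Proof.
move=> mobZ ordZ [_ minB]; have q_gt1 := mobius_order_gt1 mobZ ordZ.
have [z /ordZ->//|B' blB' leB'] := @greedy_blocking_set R T Z q.+1 isT.
(* The strictness of the final bound comes from here. *)
have ltH : harmonic_sum R (q * q.+1) < 1 + ln (q%:R * q.+1%:R).
  by rewrite -natrM harmonic_sum_lt_ln //; nia.
rewrite mulrAC ltr_pdivlMr ?natr1 ?ltr0n //.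
apply: le_lt_trans (_ : q.+1%:R * #|B'|%:R < _).
  by rewrite mulrC ler_wpM2l ?ler_nat ?minB.
apply: le_lt_trans leB' _.
rewrite (eq_bigr (fun=> harmonic_sum R (q * q.+1))) => [|x _]; last first.
  by rewrite (card_star1 mobZ ordZ).
rewrite sumr_const (card_mobius_points mobZ ordZ) -[ltLHS]mulr_natl.
by rewrite -natrX natr1 ltr_pM2l ?ltr0n.
Qed.
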